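(* For any graph $G$ and any integer $m\ge 1$, we have $$\beta(G) \leq dem(G \vee mK_1) \leq \beta(G)+m.$$ Moreover, the bounds are sharp (each of the two bounds is attained for some $G$ and $m$).
   Context: Graphs are finite, undirected and simple. $mK_1$ is the graph with $m$ vertices and no edges; $G\vee H$ is the join of $G$ and $H$ (disjoint union together with all edges between $V(G)$ and $V(H)$). $\beta(G)$ is the vertex covering number, the minimum cardinality of a set $C\subseteq V(G)$ such that every edge of $G$ has an endpoint in $C$. $d_H(x,y)$ is the distance in a graph $H$ ($\infty$ if there is no path), and $H-e$ is obtained from $H$ by deleting the edge $e$. For a vertex $x$ of $H$, $EM(x)$ is the set of edges $e\in E(H)$ such that there exists $y\in V(H)$ with $d_H(x,y)\neq d_{H-e}(x,y)$. A set $M\subseteq V(H)$ is a distance-edge-monitoring set if $\bigcup_{x\in M}EM(x)=E(H)$, and $dem(H)$ is the smallest size of a distance-edge-monitoring set of $H$. *)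

(* Defs.v *)
From mathcomp Require Import all_boot.

Set Implicit Arguments.
Unset Strict Implicit.
Unset Printing Implicit Defensive.

Record sgraph := SGraph {
  vertex :> finType;
  adj : rel vertex;
  adj_sym : symmetric adj;
  adj_irr : irreflexive adj }.

Arguments adj {s} : rename.

Section Edges.
Variable G : sgraph.

Definition edges : {set {set G}} :=
  [set e | [exists x : G, exists y : G, adj x y && (e == [set x; y])]].

Lemma edgesP (e : {set G}) :
  reflect (exists x y : G, adj x y /\ e = [set x; y]) (e \in edges).
Proof.
rewrite inE; apply: (iffP existsP) => [[x /existsP[y /andP[xy /eqP ->]]]|].
  by exists x, y.
by move=> [x [y [xy ->]]]; exists x; apply/existsP; exists y; rewrite xy eqxx.
Qed.

Definition del_adj (e : {set G}) : rel G :=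
  fun x y => adj x y && ([set x; y] != e).

Lemma del_adj_sym e : symmetric (del_adj e).
Proof. by move=> x y; rewrite /del_adj adj_sym setUC. Qed.

Lemma del_adj_irr e : irreflexive (del_adj e).
Proof. by move=> x; rewrite /del_adj adj_irr. Qed.

Definition del_edge (e : {set G}) : sgraph :=
  SGraph (del_adj_sym e) (del_adj_irr e).

End Edges.

Section Join.
Variables G H : sgraph.

Definition join_adj : rel (G + H)%type := fun u v =>
  match u, v with
  | inl x, inl y => adj x y
  | inr x, inr y => adj x y
  | _, _ => true
  end.

Lemma join_adj_sym : symmetric join_adj.
Proof. by move=> [x|x] [y|y] //=; exact: adj_sym. Qed.

Lemma join_adj_irr : irreflexive join_adj.
Proof. by move=> [x|x] /=; exact: adj_irr. Qed.

Definition graph_join : sgraph := SGraph join_adj_sym join_adj_irr.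

End Join.

Definition edgeless (m : nat) : sgraph :=
  @SGraph 'I_m (fun _ _ => false) (fun _ _ => erefl) (fun _ => erefl).

Section Distance.
Variable G : sgraph.

Definition walk (x y : G) (n : nat) : bool :=
  [exists p : n.-tuple G, path adj x p && (last x p == y)].

Lemma connect_walk (x y : G) : connect adj x y -> exists n, walk x y n.
Proof.
move=> /connectP[p xp ->]; exists (size p); apply/existsP.
by exists (in_tuple p); rewrite xp eqxx.
Qed.

(* [None] stands for infinity. *)
Definition dist (x y : G) : option nat :=
  match @idP (connect adj x y) with
  | ReflectT xy => Some (ex_minn (connect_walk xy))
  | ReflectF _ => None
  end.

Lemma dist_Some (x y : G) (d : nat) :
  dist x y = Some d <-> walk x y d /\ (forall n, walk x y n -> d <= n).
Proof.
rewrite /dist; case: {-}_ / idP => [xy|nxy].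
  case: ex_minnP => k wk kmin; split => [[<-]|[wd dmin]]; first by split.
  by congr Some; apply/eqP; rewrite eqn_leq kmin // dmin.
split=> // -[/existsP[p /andP[xp /eqP yp]] _]; case: nxy.
by apply/connectP; exists p.
Qed.

End Distance.

Definition vertex_cover (G : sgraph) (C : {set G}) : bool :=
  [forall x : G, forall y : G, adj x y ==> (x \in C) || (y \in C)].

Definition vertex_cover_number (G : sgraph) : nat :=
  #|[arg min_(C < [set: G] | vertex_cover C) #|C|]|.

Definition EM (G : sgraph) (x : G) : {set {set G}} :=
  [set e in edges G |
     [exists y : G, dist x y != @dist (del_edge e) x y]].

Definition dem_set (G : sgraph) (M : {set G}) : bool :=
  \bigcup_(x in M) EM x == edges G.

Definition dem (G : sgraph) : nat :=
  #|[arg min_(M < [set: G] | dem_set M) #|M|]|.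

(* The defaults [set: G] of the two minima are admissible, so that the minima
   range over nonempty families. *)
Lemma vertex_coverT (G : sgraph) : vertex_cover [set: G].
Proof. by apply/forallP=> x; apply/forallP=> y; rewrite inE implybT. Qed.

Lemma dem_setT (G : sgraph) : dem_set [set: G].
Proof.
rewrite /dem_set eqEsubset; apply/andP; split.
  by apply/bigcupsP => x _; apply/subsetP => e; rewrite inE => /andP[].
apply/subsetP => e eG; have /edgesP[x [y [xy eE]]] := eG.
apply/bigcupP; exists x; first exact: in_setT.
rewrite /EM in_set eG /=; apply/existsP; exists y.
have nxy : x != y by apply/eqP => xy'; rewrite xy' adj_irr in xy.
have d1 : dist x y = Some 1.
  apply/dist_Some; split.
    by apply/existsP; exists [tuple y]; rewrite /= xy eqxx.
  case=> // /existsP[p]; rewrite (tuple0 p) /= => /eqP xy'.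
  by rewrite xy' eqxx in nxy.
rewrite d1 eq_sym; apply/eqP => /dist_Some[/existsP[p]] + _.
case/tupleP: p => z p; rewrite (tuple0 p) /= andbT => /andP[xz /eqP zy].
by move: xz; rewrite zy /del_adj /= eE eqxx andbF.
Qed.

(* Main.v *)
(** An edge [e] is monitored by each of its ends, so every vertex cover is a
    distance-edge-monitoring set; adding the [m] new vertices to a vertex cover
    of [G] covers the join, whence the upper bound.  Conversely, in the join any
    two non-adjacent vertices have a common neighbour on the other side, so
    deleting an edge [e] of [G] changes no distance from a vertex outside [e]:
    only the ends of [e] monitor it, and the trace on [G] of a monitoring set is
    a vertex cover.  The lower bound is attained by [2K_2] and [m = 1], where the
    new vertex is the only common neighbour of the two copies of [K_2], and the
    upper bound by [K_1] and [m = 1]. *)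
Require Import Defs.
From mathcomp Require Import all_boot.

Set Implicit Arguments.
Unset Strict Implicit.
Unset Printing Implicit Defensive.

Section Walks.
Variable G : sgraph.
Implicit Types (x y : G) (n : nat).

Lemma walk0 x y : walk x y 0 = (x == y).
Proof.
apply/existsP/idP => [[p]|xy]; first by rewrite tuple0.
by exists [tuple].
Qed.

Lemma walkS x y n : walk x y n.+1 = [exists z, adj x z && walk z y n].
Proof.
apply/existsP/existsP => [[p]|[z /andP[xz /existsP[p zp]]]].
  case/tupleP: p => z p /= /andP[/andP[xz zp] py].
  by exists z; rewrite xz; apply/existsP; exists p; rewrite zp.
by exists [tuple of z :: p]; rewrite /= xz.
Qed.

Lemma walk1 x y : walk x y 1 = adj x y.
Proof.
rewrite walkS; apply/existsP/idP => [[z /andP[xz]]|xy].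
  by rewrite walk0 => /eqP <-.
by exists y; rewrite xy walk0 eqxx.
Qed.

Lemma walk2 x y : walk x y 2 = [exists z, adj x z && adj z y].
Proof. by rewrite walkS; apply: eq_existsb => z; rewrite walk1. Qed.

Lemma dist_NoneP x y : reflect (forall n, ~~ walk x y n) (dist x y == None).
Proof.
rewrite /dist; case: {-}_ / idP => [xy|nxy]; constructor.
  by have [n wn] := connect_walk xy => /(_ n); rewrite wn.
move=> n; apply/negP => /existsP[p /andP[xp /eqP yp]]; apply: nxy.
by apply/connectP; exists p.
Qed.

End Walks.

Section Monitoring.
Variable G : sgraph.
Implicit Types (x y z : G) (e : {set G}).

Lemma walk_del e x y n : @walk (del_edge e) x y n -> walk x y n.
Proof.
elim: n x => [|n IHn] x; first by rewrite !walk0.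
rewrite !walkS => /existsP[z /andP[/andP[xz _] /IHn zy]].
by apply/existsP; exists z; rewrite xz.
Qed.

(** Every walk of [del_edge e] is a walk of [G], so deletion can only increase distances. It thus
    suffices to exhibit one length [n], not necessarily minimal, that is reached in [G] but by no
    surviving walk of length at most [n]. *)
Lemma EMP e x : e \in edges G ->
  reflect (exists y n, walk x y n /\
             forall k, k <= n -> ~~ @walk (del_edge e) x y k)
          (e \in EM x).
Proof.
move=> eG; rewrite inE eG /=.
apply: (iffP existsP) => [[y]|[y [n [xy nxy]]]]; last first.
  exists y; apply/negP => /eqP.
  case E: (dist x y) => [d|]; last first.
    by move/eqP: E => /dist_NoneP/(_ n); rewrite xy.
  move/dist_Some: E => [_ /(_ n xy) dn] /esym/dist_Some[wd _].
  by have := nxy d dn; rewrite wd.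
case E: (dist x y) => [d|] neq.
  have [wd dmin] := (dist_Some _ _ _).1 E.
  (* A surviving walk of length [k <= d] would be a walk of [G], hence [k = d] by minimality, and
     both distances would be [d]. *)
  exists y, d; split=> // k kd; apply: contra neq => wk.
  rewrite eq_sym; apply/eqP/dist_Some; split=> [|n /walk_del]; last exact: dmin.
  suff -> : d = k by [].
  by apply/eqP; rewrite eqn_leq kd dmin // (walk_del wk).
move/eqP: E => /dist_NoneP nw; case/eqP: neq; apply/esym/eqP/dist_NoneP => n.
by apply: contra (nw n) => /walk_del.
Qed.

Lemma mem_edges x y : adj x y -> [set x; y] \in edges G.
Proof. by move=> xy; apply/edgesP; exists x, y. Qed.

Lemma EM_incident x y : adj x y -> [set x; y] \in EM x.
Proof.
move=> xy; apply/EMP; first exact: mem_edges.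
exists y, 1; rewrite walk1; split=> // -[|[|//]] _.
  by rewrite walk0; apply: contraTneq xy => ->; rewrite adj_irr.
by rewrite walk1 /= /del_adj eqxx andbF.
Qed.

Lemma dem_setP (M : {set G}) :
  reflect (forall x y, adj x y -> exists2 z, z \in M & [set x; y] \in EM z)
          (dem_set M).
Proof.
apply: (iffP eqP) => [ME x y /mem_edges|ME].
  by rewrite -ME => /bigcupP.
apply/eqP; rewrite eqEsubset; apply/andP; split.
  by apply/bigcupsP => x _; apply/subsetP => e; rewrite inE => /andP[].
apply/subsetP => _ /edgesP[x [y [/ME[z zM ez] ->]]].
by apply/bigcupP; exists z.
Qed.

Lemma vertex_coverP (C : {set G}) :
  reflect (forall x y, adj x y -> (x \in C) || (y \in C)) (vertex_cover C).
Proof.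
apply: (iffP forallP) => [H x y|H x].
  by move/forallP: (H x) => /(_ y)/implyP.
by apply/forallP => y; apply/implyP/H.
Qed.

Lemma vertex_cover_dem_set (C : {set G}) : vertex_cover C -> dem_set C.
Proof.
move=> /vertex_coverP CC; apply/dem_setP => x y xy.
case/orP: (CC x y xy) => [xC|yC]; [exists x | exists y] => //.
  exact: EM_incident.
by rewrite setUC; apply: EM_incident; rewrite adj_sym.
Qed.

Lemma vertex_cover_number_le (C : {set G}) :
  vertex_cover C -> vertex_cover_number G <= #|C|.
Proof.
rewrite /vertex_cover_number => CC.
by case: arg_minnP => [|D _]; [exact: vertex_coverT | exact].
Qed.

Lemma vertex_cover_number_attained :
  exists2 C : {set G}, vertex_cover C & #|C| = vertex_cover_number G.
Proof.
rewrite /vertex_cover_number; case: arg_minnP => [|D ? _].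
  exact: vertex_coverT.
by exists D.
Qed.

Lemma dem_le (M : {set G}) : dem_set M -> dem G <= #|M|.
Proof.
rewrite /dem => MM.
by case: arg_minnP => [|D _]; [exact: dem_setT | exact].
Qed.

Lemma dem_attained : exists2 M : {set G}, dem_set M & #|M| = dem G.
Proof.
rewrite /dem; case: arg_minnP => [|D ? _]; first exact: dem_setT.
by exists D.
Qed.

Lemma dem_gt0 x y : adj x y -> 0 < dem G.
Proof.
move=> xy; have [M /dem_setP/(_ x y xy)[z zM _] <-] := dem_attained.
by apply/card_gt0P; exists z.
Qed.

(** The deleted edge ends the only path of length 2 from [x] to [y], so their distance 2 is lost. *)
Lemma EM_via x y z : x != y -> ~~ adj x y -> adj x z -> adj z y ->
    (forall t, adj x t -> adj t y -> t = z) ->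
  [set z; y] \in EM x.
Proof.
move=> xy nxy xz zy z_uniq; apply/EMP; first exact: mem_edges.
exists y, 2; split; first by rewrite walk2; apply/existsP; exists z; rewrite xz.
move=> [|[|[|//]]] _; first by rewrite walk0.
  by rewrite walk1 /= /del_adj (negPf nxy).
rewrite walk2; apply/negP => /existsP[t /andP[/andP[xt _] /andP[ty /eqP]]].
by rewrite (z_uniq t).
Qed.

End Monitoring.

Section JoinEdgeless.
Variables (G : sgraph) (m : nat).
Let H := graph_join G (edgeless m).

Lemma EM_join (x y : G) (z : H) : 0 < m -> adj x y ->
  [set (inl x : H); inl y] \in EM z -> z \in [set (inl x : H); inl y].
Proof.
move=> m_gt0 xy; set e : {set H} := [set inl x; inl y] => ez; apply: contraLR ez => ze.
apply/EMP; first exact: (@mem_edges H).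
have e_inr (i : edgeless m) (a : H) : [set inr i; a] != e.
  by apply: contraNneq ze => /setP/(_ (inr i)); rewrite !inE eqxx.
have e_z (a : H) : [set z; a] != e by apply: contraNneq ze => <-; rewrite !inE eqxx.
(* Since [z] lies outside [e], all its edges survive; walks of length 0 or 1 are therefore
   unaffected. *)
have del_z (a : H) : @adj (del_edge e) z a = adj z a by rewrite /= /del_adj e_z andbT.
case=> t [n [zt noP]]; case: n => [|[|n]] in zt noP.
- by have := noP 0 isT; rewrite !walk0 in zt *; rewrite zt.
- by have := noP 1 isT; rewrite !walk1 del_z in zt *; rewrite zt.
have := noP 1 isT; rewrite walk1 del_z => nzt.
have /negP := noP 2 isT; rewrite walk2; apply.
(* For longer walks it remains to find a two-step detour whose second edge is not [e]. *)
have mid (w : H) : adj z w -> adj w t -> [set w; t] != e ->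
    [exists u, @adj (del_edge e) z u && @adj (del_edge e) u t].
  by move=> zw wt we; apply/existsP; exists w; rewrite del_z zw /= /del_adj wt.
(* Vertices on opposite sides are adjacent. Two vertices of [G] meet at a new vertex, which exists
   as [0 < m], and two new ones meet at [inl x]; an edge at a new vertex is never [e]. *)
case: z t {zt noP ze e_z del_z} nzt mid => [v|i] [u|j] //= _ mid.
  exact: (mid (inr (Ordinal m_gt0))).
by apply: (mid (inl x)) => //; rewrite setUC.
Qed.

Lemma vertex_cover_number_le_dem_join :
  0 < m -> vertex_cover_number G <= dem H.
Proof.
move=> m_gt0; have [M /dem_setP MM <-] := dem_attained H.
have inl_inj : injective (inl : G -> H) by move=> ? ? [].
apply: leq_trans (_ : #|(inl : G -> H) @^-1: M| <= _); last first.
  rewrite -(card_imset _ inl_inj); apply/subset_leq_card/subsetP => z.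
  by case/imsetP => x; rewrite inE => ? ->.
apply/vertex_cover_number_le/vertex_coverP => x y xy; rewrite !inE.
have [z zM /(EM_join m_gt0 xy)] := MM (inl x) (inl y) xy.
by rewrite !inE => /orP[]/eqP <-; rewrite zM ?orbT.
Qed.

Lemma dem_join_le : dem H <= vertex_cover_number G + m.
Proof.
have [C /vertex_coverP CC <-] := vertex_cover_number_attained G.
pose D : {set H} := inl @: C :|: inr @: [set: 'I_m].
have inlD x : x \in C -> inl x \in D by move=> xC; rewrite inE imset_f.
have inrD i : inr i \in D by rewrite inE imset_f ?orbT.
apply: leq_trans (_ : #|D| <= _).
  apply/dem_le/vertex_cover_dem_set/vertex_coverP.
  move=> [x|i] [y|j]; rewrite ?inrD ?orbT //= => /CC.
  by case/orP => /inlD ->; rewrite ?orbT.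
apply: leq_trans (leq_card_setU _ _) _.
apply: leq_add; first exact: leq_imset_card.
by apply: leq_trans (leq_imset_card _ _) _; rewrite cardsT card_ord.
Qed.

End JoinEdgeless.

(** The first coordinate names the copy of K_2, the second one of its ends. *)
Definition twoK2_adj : rel (bool * bool) :=
  fun x y => (x.1 == y.1) && (x.2 != y.2).

Lemma twoK2_adj_sym : symmetric twoK2_adj.
Proof. by move=> x y; rewrite /twoK2_adj eq_sym [x.2 == _]eq_sym. Qed.

Lemma twoK2_adj_irr : irreflexive twoK2_adj.
Proof. by move=> x; rewrite /twoK2_adj !eqxx. Qed.

Definition twoK2 : sgraph := SGraph twoK2_adj_sym twoK2_adj_irr.

Lemma vertex_cover_number_twoK2 : 2 <= vertex_cover_number twoK2.
Proof.
have [C /vertex_coverP CC <-] := vertex_cover_number_attained twoK2.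
rewrite -card_bool -cardsT.
(* A cover meets both copies, so [fst] maps it onto [bool]. *)
apply: leq_trans (leq_imset_card (fst : twoK2 -> bool) (mem C)).
apply/subset_leq_card/subsetP => b _.
have := CC (b, true) (b, false); rewrite /= /twoK2_adj /= eqxx => /(_ isT).
by case/orP => bC; apply/imsetP; eexists; eauto.
Qed.

Lemma dem_join_twoK2 : dem (graph_join twoK2 (edgeless 1)) <= 2.
Proof.
set H := graph_join _ _.
(* One end from each copy of K_2. *)
pose M : {set H} := [set inl (b, true) | b : bool].
have MP b : inl (b, true) \in M by rewrite imset_f.
apply: leq_trans (_ : #|M| <= 2); last first.
  by rewrite -card_bool; apply: leq_imset_card.
have hub (a : twoK2) (i : edgeless 1) :
    exists2 z, z \in M & [set inl a; inr i] \in EM (z : H).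
  case: a => b [].
    by exists (inl (b, true)) => //; apply: EM_incident.
  (* The end of copy [b] outside [M] is monitored from the other copy: the single new vertex is
     their only common neighbour. *)
  exists (inl (~~ b, true)) => //; rewrite setUC; apply: EM_via => //.
  - by case: b.
  - by case: b.
  - case=> [[c d]|j] /=; last by rewrite (ord1 i) (ord1 j).
    by rewrite /twoK2_adj /=; case: b c => -[].
apply/dem_le/dem_setP => -[[b c]|i] [a|j] //= adj_xy.
- case: a adj_xy => b' c' /andP[/= /eqP <-{b'} cc'].
  exists (inl (b, true)) => //.
  have edge : @adj H (inl (b, true)) (inl (b, false)).
    by rewrite /= /twoK2_adj /= eqxx.
  by case: c c' cc' => -[] // _; [|rewrite setUC]; exact: (EM_incident edge).
- by rewrite setUC.
Qed.

Theorem corollary4p18 :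
  (forall (G : sgraph) (m : nat), 1 <= m ->
     vertex_cover_number G <= dem (graph_join G (edgeless m))
       <= vertex_cover_number G + m) /\
  (exists (G : sgraph) (m : nat),
     [/\ 0 < #|G|, 1 <= m &
         dem (graph_join G (edgeless m)) = vertex_cover_number G]) /\
  (exists (G : sgraph) (m : nat),
     [/\ 0 < #|G|, 1 <= m &
         dem (graph_join G (edgeless m)) = vertex_cover_number G + m]).
Proof.
split; last split.
- by move=> G m m_gt0; rewrite vertex_cover_number_le_dem_join ?dem_join_le.
- exists twoK2, 1; split=> //; first by apply/card_gt0P; exists (true, true).
  apply/eqP; rewrite eqn_leq vertex_cover_number_le_dem_join // andbT.
  exact: leq_trans dem_join_twoK2 vertex_cover_number_twoK2.
- exists (edgeless 1), 1; split=> //; first by rewrite card_ord.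
  apply/eqP; rewrite eqn_leq dem_join_le /=.
  (* The covering number of K_1 is 0, so the upper bound is 1, and it is attained because the join
     has an edge to monitor. *)
  have cover0 : vertex_cover (set0 : {set edgeless 1}) by apply/vertex_coverP.
  have := vertex_cover_number_le cover0; rewrite cards0 leqn0 => /eqP ->.
  exact: (@dem_gt0 (graph_join (edgeless 1) (edgeless 1)) (inl ord0) (inr ord0)).
Qed.
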